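(* Let $\theta=[a_1,a_2,\dots]$ be an irrational with $a_1=a_2=a_3=1$, and let $f$ be a $\theta$-recurrent unimodal map with critical orbit $x_k=f^k(0)$. Then for $k>0$: (1) $x_{q_n}<0$ if $n\equiv0,1\pmod 4$ and $x_{q_n}>0$ otherwise; (2) if $k=\gamma q_n$ with $1<\gamma\le a_{n+1}$, then $x_{q_n}$ and $x_{k}$ have opposite signs; (3) if $k=\sum_{n\ge m}\gamma_nq_n$ is the Ostrowski representation of $k$ with $\gamma_m>0$ its lowest nonzero digit, then $x_k$ and $x_{\gamma_mq_m}$ have the same sign.
   Context: Let $I=[-1,1]$. A unimodal map is a continuous $f:I\to I$ strictly decreasing on $[-1,0]$, strictly increasing on $[0,1]$, $f(\pm1)=1$. For $x\neq0$ let $x'$ be the other point with $f(x')=f(x)$, $0':=0$, $I_x$ the closed interval with endpoints $x,x'$. $\theta=[a_1,a_2,\dots]=1/(a_1+1/(a_2+\cdots))$, $q_n$ the denominator of $[a_1,\dots,a_n]$ ($q_n=a_nq_{n-1}+q_{n-2}$; here $q_1=1,q_2=2,q_3=3$). For $x\in I$ with orbit $x_k=f^k(x)$, $k\ge1$ is a time of closest recurrence of $x$ to $I_x$ if $f(x_k)<f(x_j)$ for all $0<j<k$. For $\theta_N=[a_1,\dots,a_N]$, $x$ has $\theta_N$-recurrence if: (i) $x_k\notin I_x$ for $k=1,\dots,q_N$; (ii) the times of closest recurrence of $x$ to $I_x$ in $\{1,\dots,q_N\}$ are exactly $q_1,\dots,q_N$; (iii) for $m=0,\dots,a_N-1$,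 $x_{mq_{N-1}}$ has $[a_1,\dots,a_{N-1}]$-recurrence (void for $N=1$). $f$ is $\theta$-recurrent if $0$ has $[a_1,\dots,a_n]$-recurrence for every $n$. Ostrowski representation: every positive integer $k$ is uniquely $k=\sum_{n\ge1}\gamma_nq_n$ with integers $0\le\gamma_n\le a_{n+1}$, finitely many nonzero, and $\gamma_n=a_{n+1}\Rightarrow\gamma_{n-1}=0$. *)

(* Defs.v *)
From Stdlib Require Import Reals Lra Lia Arith.
Open Scope R_scope.

Definition inI (x : R) : Prop := -1 <= x <= 1.

(* Unimodal map f : I -> I (given as a function R -> R; only its values on I matter). *)
Definition unimodal (f : R -> R) : Prop :=
  (forall x, inI x -> inI (f x)) /\
  (forall x, inI x -> forall eps, 0 < eps -> exists delta, 0 < delta /\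
      forall y, inI y -> Rabs (y - x) < delta -> Rabs (f y - f x) < eps) /\
  (forall x y, -1 <= x -> x < y -> y <= 0 -> f y < f x) /\
  (forall x y, 0 <= x -> x < y -> y <= 1 -> f x < f y) /\
  f (-1) = 1 /\ f 1 = 1.

Definition is_prime (f : R -> R) (x x' : R) : Prop :=
  (x = 0 /\ x' = 0) \/ (x <> 0 /\ inI x' /\ x' <> x /\ f x' = f x).

Definition in_Ix (f : R -> R) (x y : R) : Prop :=
  exists x', is_prime f x x' /\ Rmin x x' <= y <= Rmax x x'.

Definition orb (f : R -> R) (k : nat) (x : R) : R := Nat.iter k f x.

Definition closest_time (f : R -> R) (x : R) (k : nat) : Prop :=
  (1 <= k)%nat /\ forall j, (0 < j < k)%nat -> f (orb f k x) < f (orb f j x).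

(* Continued fraction denominators: q 0 = 1 (q_{-1} = 0 implicit), q 1 = a 1,
   q (n+2) = a (n+2) * q (n+1) + q n.  The digits a_1, a_2, ... are a 1, a 2, ... *)
Fixpoint q_aux (a : nat -> nat) (n : nat) : nat * nat :=
  match n with
  | O => (1%nat, 0%nat)
  | S m => let (qm, qm1) := q_aux a m in (a (S m) * qm + qm1, qm)%nat
  end.
Definition q (a : nat -> nat) (n : nat) : nat := fst (q_aux a n).

(* x has [a_1,...,a_N]-recurrence (N >= 1); for N = 0 the predicate is True and
   serves only as the void base case of condition (iii). *)
Fixpoint has_recurrence (a : nat -> nat) (f : R -> R) (N : nat) (x : R) : Prop :=
  match N with
  | O => True
  | S N' =>
      (forall k, (1 <= k <= q a N)%nat -> ~ in_Ix f x (orb f k x)) /\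
      (forall k, (1 <= k <= q a N)%nat ->
         (closest_time f x k <-> exists n, (1 <= n <= N)%nat /\ k = q a n)) /\
      (forall m, (m < a N)%nat -> has_recurrence a f N' (orb f (m * q a N') x))
  end.

Definition theta_recurrent (a : nat -> nat) (f : R -> R) : Prop :=
  forall n, (1 <= n)%nat -> has_recurrence a f n 0.

Fixpoint ost_sum (a : nat -> nat) (g : nat -> nat) (N : nat) : nat :=
  match N with
  | O => O
  | S M => (ost_sum a g M + g (S M) * q a (S M))%nat
  end.

(* g (indexed from 1, g 0 ignored) is an admissible Ostrowski digit sequence,
   vanishing beyond N *)
Definition ostrowski_digits (a : nat -> nat) (g : nat -> nat) (N : nat) : Prop :=
  (forall n, (N < n)%nat -> g n = 0%nat) /\
  (forall n, (1 <= n)%nat -> (g n <= a (S n))%nat) /\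
  (forall n, (2 <= n)%nat -> g n = a (S n) -> g (n - 1)%nat = 0%nat).

(* Main.v *)
Require Import Defs.
From Stdlib Require Import Reals Lra Lia Arith.
Open Scope R_scope.

(* Let [x_k] be the critical orbit, call [x_i] closer than [x_j] when [f x_i < f x_j], and let
   [h] be a time whose orbit has [[a_1,...,a_n]]-recurrence. As long as two orbit segments have
   equal signs, the order of their points is preserved or reversed according to the parity of
   the number of negative points met so far. The key is a parity invariant: among
   [x_{h+1},...,x_{h+q_{n-2}}] an odd number of points is negative. Indeed the signs along [h]
   and along [h + a_n q_{n-1}] agree before time [q_{n-2}], and at that time the second point is
   [x_{h+q_n}], a closest return, so the order must have been carried towards [0]. The same
   comparisons show that the sign pattern of a block of length [q_{n-1}] is repeated along
   [h + m q_{n-1}], up to the multiples of [q_{n-1}] themselves; for [h = 0] this is (3) with the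
   top Ostrowski digit removed. Parity forces the sign changes at the multiples, which is (2),
   and comparing the parities of [q_n] and [q_{n+2}] gives [sgn x_{q_{n+2}} = - sgn x_{q_n}],
   which is (1). *)

Lemma q_SS (a : nat -> nat) (n : nat) :
  q a (S (S n)) = (a (S (S n)) * q a (S n) + q a n)%nat.
Proof.
  unfold q; simpl.
  destruct (q_aux a n) as [u v]; reflexivity.
Qed.

(** * Order and signs along an orbit folded at [0] *)

Section FoldedOrbit.

(* All that is used of the critical orbit [x]: it is infinite, starts at [0], and its shift is
   monotone on either side of [0]. *)
Variable x : nat -> R.
Hypothesis x_0 : x 0%nat = 0.
Hypothesis x_inj : forall i j, x i = x j -> i = j.
Hypothesis x_pos_mono : forall i j, 0 <= x i -> x i < x j -> x (S i) < x (S j).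
Hypothesis x_neg_mono : forall i j, x j <= 0 -> x i < x j -> x (S j) < x (S i).

(* As [x (S i)] is [f (x i)], this compares the distances to [0] as measured by [f]. *)
Definition closer (i j : nat) : Prop := x (S i) < x (S j).

(** Index [0], where [x] vanishes, gets the default [-1]; by injectivity no other point is [0]. *)
Definition sg (i : nat) : R := if Rlt_dec 0 (x i) then 1 else -1.

(** The parity of the number of negative points at times [u + 1] to [u + k]. The sign at [u] is left
    out because [closer u v] already compares the points at [S u] and [S v]. *)
Fixpoint sgprod (u k : nat) : R :=
  match k with
  | O => 1
  | S k => sgprod u k * sg (u + S k)
  end.

Definition is_sign (t : R) : Prop := t = 1 \/ t = -1.

Lemma sg_is_sign i : is_sign (sg i).
Proof. unfold sg; destruct (Rlt_dec 0 (x i)); [left|right]; reflexivity. Qed.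

Lemma is_sign_mul s t : is_sign s -> is_sign t -> is_sign (s * t).
Proof. intros [-> | ->] [-> | ->]; [left|right|right|left]; lra. Qed.

Lemma sgprod_is_sign u k : is_sign (sgprod u k).
Proof.
  induction k as [|k IH]; [left; reflexivity|].
  apply is_sign_mul; [exact IH | apply sg_is_sign].
Qed.

Lemma sg_mul_pos i : (1 <= i)%nat -> 0 < sg i * x i.
Proof.
  intros Hi.
  assert (x i <> 0) by (intros H; rewrite <- x_0 in H; apply x_inj in H; lia).
  unfold sg; destruct (Rlt_dec 0 (x i)); lra.
Qed.

Lemma sg_unique t i : is_sign t -> 0 < t * x i -> sg i = t.
Proof.
  intros [-> | ->] H; unfold sg; destruct (Rlt_dec 0 (x i)); lra.
Qed.

Lemma sg_neq t i : is_sign t -> sg i <> t -> sg i = - t.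
Proof.
  intros Ht H. destruct (sg_is_sign i), Ht; lra.
Qed.

Lemma closer_trans i j k : closer i j -> closer j k -> closer i k.
Proof. unfold closer; lra. Qed.

Lemma closer_irrefl i : ~ closer i i.
Proof. unfold closer; lra. Qed.

Lemma closer_total i j : i <> j -> closer i j \/ closer j i.
Proof.
  intros H. unfold closer.
  destruct (Rtotal_order (x (S i)) (x (S j))) as [h|[h|h]]; auto.
  apply x_inj in h. lia.
Qed.

Lemma sg_mul_closer t i j : is_sign t ->
  0 <= t * x i -> t * x i < t * x j -> closer i j.
Proof.
  intros [-> | ->] Hi Hij; unfold closer.
  - apply x_pos_mono; lra.
  - apply x_neg_mono; lra.
Qed.

Lemma closer_sg_mul i j : (1 <= j)%nat -> closer i j -> sg j * x i < sg j * x j.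
Proof.
  intros Hj H. assert (Hp := sg_mul_pos j Hj). assert (Hs := sg_is_sign j).
  destruct (Rlt_le_dec (sg j * x i) (sg j * x j)) as [h|h]; [exact h|exfalso].
  destruct (Rle_lt_or_eq_dec _ _ h) as [h'|h'].
  - apply (closer_irrefl i), (closer_trans _ j); [exact H|].
    apply (sg_mul_closer (sg j)); [exact Hs|lra|lra].
  - assert (E : x i = x j) by (destruct Hs as [E|E]; rewrite E in h'; lra).
    apply x_inj in E. subst. exact (closer_irrefl _ H).
Qed.

(** On the side [- t], [x j] would lie between [x i] and [0], hence be closer than [x i]. *)
Lemma sg_of_farther t i j : is_sign t -> (1 <= j)%nat ->
  closer i j -> t * x i < t * x j -> sg j = t.
Proof.
  intros Ht Hj H1 H2. apply closer_sg_mul in H1; [|exact Hj].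
  destruct (sg_is_sign j) as [E|E], Ht as [-> | ->]; rewrite E in H1; lra.
Qed.

Lemma sg_step t i j : is_sign t -> (1 <= i)%nat -> (1 <= j)%nat -> sg i = sg j ->
  t * x i < t * x j -> t * sg i * x (S i) < t * sg i * x (S j).
Proof.
  intros Ht Hi Hj E H.
  assert (Pi := sg_mul_pos i Hi). assert (Pj := sg_mul_pos j Hj). rewrite <- E in Pj.
  destruct Ht as [-> | ->], (sg_is_sign i) as [E'|E']; rewrite E' in *.
  - assert (x (S i) < x (S j)) by (apply x_pos_mono; lra). lra.
  - assert (x (S j) < x (S i)) by (apply x_neg_mono; lra). lra.
  - assert (x (S j) < x (S i)) by (apply x_pos_mono; lra). lra.
  - assert (x (S i) < x (S j)) by (apply x_neg_mono; lra). lra.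
Qed.

Lemma transport u v k : closer u v ->
  (forall i, (0 < i <= k)%nat -> sg (u + i) = sg (v + i)) ->
  sgprod u k * x (u + S k) < sgprod u k * x (v + S k).
Proof.
  intros H. induction k as [|k IH]; intros Hs.
  - rewrite !Nat.add_1_r. simpl. unfold closer in H. lra.
  - simpl sgprod. rewrite (Nat.add_succ_r u (S k)), (Nat.add_succ_r v (S k)).
    apply sg_step; try lia.
    + apply sgprod_is_sign.
    + apply Hs; lia.
    + apply IH. intros i Hi; apply Hs; lia.
Qed.

(** While all signs agree, the point along [v] stays between those along [u] and [w]; when these two
    share a sign it has that sign too, which carries the agreement one step further. *)
Lemma sandwich u v w k : closer u v -> closer v w ->
  (forall i, (0 < i < k)%nat -> sg (u + i) = sg (w + i)) ->
  forall i, (0 < i < k)%nat -> sg (v + i) = sg (u + i).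
Proof.
  intros Huv Hvw Hs i. induction i as [i IH] using lt_wf_ind. intros Hi.
  destruct i as [|i]; [lia|].
  assert (IH' : forall j, (0 < j <= i)%nat -> sg (u + j) = sg (v + j))
    by (intros j Hj; symmetry; apply IH; lia).
  assert (T1 := transport u v i Huv IH').
  assert (T2 : sgprod v i * x (v + S i) < sgprod v i * x (w + S i)).
  { apply transport; [exact Hvw|]. intros j Hj. rewrite IH, Hs by lia. reflexivity. }
  assert (E : sgprod v i = sgprod u i).
  { clear -IH'. induction i as [|i IHi]; [reflexivity|].
    simpl. rewrite IHi, IH' by (intros; try apply IH'; lia). reflexivity. }
  rewrite E in T2.
  assert (Pu := sg_mul_pos (u + S i) ltac:(lia)).
  assert (Pw := sg_mul_pos (w + S i) ltac:(lia)).
  rewrite <- Hs in Pw by lia.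
  apply sg_unique; [apply sg_is_sign|].
  destruct (sg_is_sign (u + S i)) as [E'|E'], (sgprod_is_sign u i) as [E2|E2];
    rewrite E', ?E2 in *; lra.
Qed.

Lemma sgprod_ext u v k : (forall i, (0 < i <= k)%nat -> sg (u + i) = sg (v + i)) ->
  sgprod u k = sgprod v k.
Proof.
  induction k as [|k IH]; intros H; [reflexivity|].
  simpl. rewrite H by lia. rewrite IH; [reflexivity|]. intros; apply H; lia.
Qed.

Lemma sgprod_add u k l : sgprod u (k + l) = sgprod u k * sgprod (u + k) l.
Proof.
  induction l as [|l IH]; [rewrite Nat.add_0_r; simpl; lra|].
  rewrite Nat.add_succ_r. simpl. rewrite IH.
  replace (u + S (k + l))%nat with (u + k + S l)%nat by lia. lra.
Qed.

(** The parity counts time [r] itself, so before [r] it is opposite to [sg (w + r)]: the point that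
    started closer ends further out in that direction, whatever its own sign at time [r]. *)
Lemma transport_odd w u v r : (1 <= r)%nat -> sgprod w r = -1 -> closer u v ->
  (forall i, (0 < i < r)%nat -> sg (u + i) = sg (w + i)) ->
  (forall i, (0 < i < r)%nat -> sg (v + i) = sg (w + i)) ->
  sg (w + r) * x (v + r) < sg (w + r) * x (u + r).
Proof.
  intros Hr HP H Hu Hv. destruct r as [|r]; [lia|].
  assert (T := transport u v r H ltac:(intros; rewrite Hu, Hv by lia; reflexivity)).
  rewrite (sgprod_ext u w r) in T by (intros; apply Hu; lia).
  simpl in HP.
  destruct (sg_is_sign (w + S r)) as [E|E], (sgprod_is_sign w r) as [E'|E'];
    rewrite E, E' in *; lra.
Qed.

(** Transport puts [x (v + k)] between two points on one side of [0], and the inner one of these is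
    closer. *)
Lemma no_closest_between u v w k : (1 <= k)%nat -> closer u v -> closer v w ->
  (forall i, (0 < i <= k)%nat -> sg (w + i) = sg (u + i)) ->
  closer (v + k) (u + k) -> closer (v + k) (w + k) -> False.
Proof.
  intros Hk Huv Hvw Hs H1 H2. destruct k as [|k]; [lia|].
  assert (Sv : forall i, (0 < i < S k)%nat -> sg (v + i) = sg (u + i))
    by (apply (sandwich u v w); auto; intros; symmetry; apply Hs; lia).
  assert (T1 := transport u v k Huv ltac:(intros; symmetry; apply Sv; lia)).
  assert (T2 := transport v w k Hvw ltac:(intros; rewrite Sv, Hs by lia; reflexivity)).
  rewrite (sgprod_ext v u k) in T2 by (intros; apply Sv; lia).
  apply closer_sg_mul in H1, H2; [|lia|lia]. rewrite Hs in H2 by lia.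
  destruct (sg_is_sign (u + S k)) as [E|E], (sgprod_is_sign u k) as [E'|E'];
    rewrite E, E' in *; lra.
Qed.

(** * Denominators and recurrence times *)

Variable a : nat -> nat.
Hypothesis a_pos : forall n, (1 <= n)%nat -> (1 <= a n)%nat.
Hypothesis a1 : a 1%nat = 1%nat.

Lemma q_1 : q a 1 = 1%nat.
Proof. cbn. rewrite a1. reflexivity. Qed.

Lemma q_pos n : (1 <= q a n)%nat.
Proof.
  enough (1 <= q a n /\ 1 <= q a (S n))%nat by tauto.
  induction n as [|n [IH1 IH2]].
  - rewrite q_1. cbn. lia.
  - split; [exact IH2|]. rewrite q_SS. nia.
Qed.

Lemma q_lt_S n : (1 <= n)%nat -> (q a n < q a (S n))%nat.
Proof.
  intros Hn. destruct n as [|n]; [lia|].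
  rewrite q_SS. assert (H := q_pos n). assert (H' := a_pos (S (S n)) ltac:(lia)). nia.
Qed.

Lemma q_lt m n : (1 <= m)%nat -> (m < n)%nat -> (q a m < q a n)%nat.
Proof.
  intros Hm H. induction H as [|n H IH].
  - apply q_lt_S; lia.
  - assert (H' := q_lt_S n ltac:(lia)). lia.
Qed.

Lemma q_ge n : (n <= q a n)%nat.
Proof.
  induction n as [|n IH]; [lia|].
  destruct n as [|n]; [rewrite q_1; lia|].
  assert (H := q_lt_S (S n) ltac:(lia)). lia.
Qed.

Hypothesis a2 : a 2%nat = 1%nat.
Hypothesis a3 : a 3%nat = 1%nat.

Lemma q_2 : q a 2 = 2%nat.
Proof. rewrite q_SS, q_1, a2. reflexivity. Qed.

Lemma q_3 : q a 3 = 3%nat.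
Proof. rewrite q_SS, q_1, q_2, a3. reflexivity. Qed.

(* [has_recurrence] for the point [x h], read on the orbit. *)
Fixpoint rec (N h : nat) : Prop :=
  match N with
  | O => True
  | S N' =>
      (forall k, (1 <= k <= q a N)%nat -> closer h (h + k)) /\
      (forall k, (1 <= k <= q a N)%nat ->
         ((forall j, (0 < j < k)%nat -> closer (h + k) (h + j)) <->
          exists n, (1 <= n <= N)%nat /\ k = q a n)) /\
      (forall m, (m < a N)%nat -> rec N' (h + m * q a N'))
  end.

Lemma rec_sub N h m : rec (S N) h -> (m < a (S N))%nat -> rec N (h + m * q a N).
Proof. intros (_ & _ & H). apply H. Qed.

Lemma rec_pred N h : rec (S N) h -> rec N h.
Proof.
  intros H. apply (rec_sub N h 0) in H; [|apply a_pos; lia].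
  rewrite Nat.add_0_r in H. exact H.
Qed.

Lemma rec_closer N h k : (1 <= N)%nat -> rec N h -> (1 <= k <= q a N)%nat -> closer h (h + k).
Proof. intros HN H. destruct N; [lia|]. apply H. Qed.

Lemma rec_before N h n j : rec N h -> (1 <= n <= N)%nat -> (0 < j < q a n)%nat ->
  closer (h + q a n) (h + j).
Proof.
  intros H Hn Hj. destruct N as [|N]; [lia|]. destruct H as (_ & H & _).
  assert (Hle : (q a n <= q a (S N))%nat).
  { destruct (Nat.eq_dec n (S N)) as [->|]; [lia|].
    assert (T := q_lt n (S N) ltac:(lia) ltac:(lia)). lia. }
  apply (H (q a n)); [lia| |exact Hj]. exists n; lia.
Qed.

(** The first time to beat [q a n] would beat every earlier one and so be a closest time, but none
    lies strictly between [q a n] and [q a (S n)]. *)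
Lemma rec_after N h n j : rec N h -> (1 <= n < N)%nat -> (0 < j < q a (S n))%nat ->
  j <> q a n -> closer (h + q a n) (h + j).
Proof.
  intros H Hn. induction j as [j IH] using lt_wf_ind. intros Hj Hne.
  destruct (Nat.lt_ge_cases j (q a n)) as [Hlt|Hge].
  { apply (rec_before N); auto; lia. }
  assert (HqN : (q a (S n) <= q a N)%nat).
  { destruct (Nat.eq_dec (S n) N) as [->|]; [lia|].
    assert (T := q_lt (S n) N ltac:(lia) ltac:(lia)). lia. }
  destruct (closer_total (h + q a n) (h + j)) as [h1|h1]; [lia|exact h1|exfalso].
  assert (Hrec : exists n', (1 <= n' <= N)%nat /\ j = q a n').
  { destruct N as [|N]; [lia|]. apply H; [lia|].
    intros i Hi. destruct (Nat.eq_dec i (q a n)) as [->|Hi']; [exact h1|].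
    apply (closer_trans _ (h + q a n)); [exact h1|]. apply IH; lia. }
  destruct Hrec as (n' & Hn' & ->).
  destruct (Nat.lt_trichotomy n' n) as [h2|[->|h2]]; [|lia|].
  - assert (T := q_lt n' n ltac:(lia) h2). lia.
  - destruct (Nat.eq_dec n' (S n)) as [->|]; [lia|].
    assert (T := q_lt (S n) n' ltac:(lia) ltac:(lia)). lia.
Qed.

(* For [n = p + 2], the signs along [h] repeat with period [q (n-1)] up to time [q n], except
   at the multiples of [q (n-1)]. *)
Definition block_periodic (p h : nat) : Prop :=
  (forall m j, (m < a (S (S p)))%nat -> (0 < j < q a (S p))%nat ->
     sg (h + m * q a (S p) + j) = sg (h + j)) /\
  (forall j, (0 < j < q a p)%nat ->
     sg (h + a (S (S p)) * q a (S p) + j) = sg (h + j)) /\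
  sgprod h (q a p) = -1.

(** * Block periodicity: multiples, base cases and tails *)

(** With [r = q a (S p)], one odd block carries [h] and [h + (m-1) r] to [h + r] and [h + m r],
    leaving the latter behind in the direction [sg (h + r)]. By [rec_after] it is also the farther
    one, so it lies across [0]. *)
Lemma sg_multiple p h m : rec (S (S p)) h -> block_periodic p h ->
  sgprod h (q a (S p)) = -1 -> (2 <= m <= a (S (S p)))%nat ->
  sg (h + m * q a (S p)) = - sg (h + q a (S p)).
Proof.
  intros H (D1 & _) HP Hm.
  assert (Hr := q_pos (S p)). assert (Hr' := q_pos p). assert (Eq := q_SS a p).
  assert (Hmr : ((m - 1) * q a (S p) + q a (S p) = m * q a (S p))%nat).
  { destruct m; [lia|]. simpl. rewrite Nat.sub_0_r. lia. }
  assert (Hle : (m * q a (S p) <= a (S (S p)) * q a (S p))%nat)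
    by (apply Nat.mul_le_mono_r; lia).
  assert (T := transport_odd h h (h + (m - 1) * q a (S p)) (q a (S p)) Hr HP).
  assert (T' : sg (h + q a (S p)) * x (h + (m - 1) * q a (S p) + q a (S p)) <
      sg (h + q a (S p)) * x (h + q a (S p))).
  { apply T.
    - apply (rec_closer (S (S p))); auto; nia.
    - reflexivity.
    - intros i Hi. apply D1; lia. }
  replace (h + (m - 1) * q a (S p) + q a (S p))%nat with (h + m * q a (S p))%nat in T' by lia.
  apply (sg_of_farther _ (h + q a (S p))).
  - destruct (sg_is_sign (h + q a (S p))) as [-> | ->]; [right|left]; lra.
  - nia.
  - apply (rec_after (S (S p))); auto; nia.
  - lra.
Qed.

Lemma sg_first h : rec 3 h -> sg (h + 1) = -1 /\ sg (h + 2) = 1.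
Proof.
  intros H.
  assert (C1 := rec_closer 3 h 1 ltac:(lia) H ltac:(rewrite q_3; lia)).
  assert (C2 := rec_before 3 h 2 1 H ltac:(lia) ltac:(rewrite q_2; lia)).
  assert (C3 := rec_before 3 h 3 2 H ltac:(lia) ltac:(rewrite q_3; lia)).
  rewrite q_2 in C2. rewrite q_3 in C3.
  (* Read on [x]: [x (h+1) < x (h+2)], [x (h+3) < x (h+2)], [x (h+4) < x (h+3)]. A wrong sign at
     time [1] or [2] turns one of the first two into the negation of the next. *)
  unfold closer in *.
  rewrite <- !Nat.add_succ_r, <- ?(Nat.add_1_r h) in *.
  split.
  - destruct (sg_is_sign (h + 1)) as [E|E]; [exfalso|exact E].
    assert (P := sg_mul_pos (h + 1) ltac:(lia)). rewrite E in P.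
    assert (T := x_pos_mono (h + 1) (h + 2) ltac:(lra) ltac:(lra)).
    rewrite <- !Nat.add_succ_r in T. lra.
  - destruct (sg_is_sign (h + 2)) as [E|E]; [exact E|exfalso].
    assert (P := sg_mul_pos (h + 2) ltac:(lia)). rewrite E in P.
    assert (T := x_neg_mono (h + 3) (h + 2) ltac:(lra) ltac:(lra)).
    rewrite <- !Nat.add_succ_r in T. lra.
Qed.

Lemma block_periodic_1 h : rec 3 h -> block_periodic 1 h.
Proof.
  intros H. destruct (sg_first h H) as [H1 _]. repeat split.
  - intros m j Hm Hj. rewrite a3 in Hm. assert (m = 0)%nat as -> by lia.
    rewrite Nat.add_0_r. reflexivity.
  - rewrite q_1. lia.
  - rewrite q_1. simpl. rewrite H1. lra.
Qed.

Lemma block_periodic_2 h : rec 4 h -> block_periodic 2 h.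
Proof.
  intros H. destruct (sg_first h (rec_pred _ _ H)) as [H1 H2].
  assert (F : forall m, (m < a 4)%nat -> sg (h + m * 3 + 1) = -1 /\ sg (h + m * 3 + 2) = 1).
  { intros m Hm. apply sg_first. assert (R3 := rec_sub 3 h m H Hm).
    rewrite q_3 in R3. exact R3. }
  unfold block_periodic. rewrite q_2, q_3. split; [|split].
  - intros m j Hm Hj. destruct (F m Hm) as [F1 F2].
    assert (j = 1 \/ j = 2)%nat as [-> | ->] by lia; congruence.
  - intros j Hj. assert (j = 1)%nat as -> by lia. rewrite H1.
    assert (Ha4 := a_pos 4 ltac:(lia)).
    assert (Q4 := q_SS a 2). rewrite q_2, q_3 in Q4.
    set (y := (h + (a 4 - 1) * 3)%nat).
    assert (Hy := rec_sub 3 h (a 4 - 1) H ltac:(lia)). rewrite q_3 in Hy. fold y in Hy.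
    destruct (F (a 4%nat - 1)%nat ltac:(lia)) as [F1 F2]. fold y in F1, F2.
    assert (Eu : (h + a 4 * 3 = y + 3)%nat) by (unfold y; lia). rewrite Eu.
    assert (C := rec_before 3 y 3 2 Hy ltac:(lia) ltac:(rewrite q_3; lia)).
    rewrite q_3 in C. unfold closer in C. rewrite <- !Nat.add_succ_r in C.
    replace (y + 3 + 1)%nat with (y + 4)%nat by lia.
    destruct (sg_is_sign (y + 4)) as [E|E]; [exfalso|exact E].
    assert (P := sg_mul_pos (y + 4) ltac:(lia)). rewrite E in P.
    (* If [x (y+4)] is positive, so is [x (y+3)]. When [a 4 = 1], then [y = h] and [h + 4] is closer
       than the return [h + 3]; otherwise transport from [h] and [y] makes [y + 3] closer than
       [h + 3]. *)
    assert (T := x_pos_mono (y + 4) (y + 3) ltac:(lra) ltac:(lra)).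
    destruct (Nat.eq_dec (a 4) 1) as [E4|E4].
    + assert (y = h) as -> by (unfold y; lia).
      assert (C' := rec_after 4 h 3 4 H ltac:(lia) ltac:(lia) ltac:(rewrite q_3; lia)).
      rewrite q_3 in C'. unfold closer in C'. lra.
    + assert (C' := rec_after 4 h 3 (3 * a 4) H ltac:(lia) ltac:(lia) ltac:(rewrite q_3; lia)).
      rewrite q_3 in C'. replace (h + 3 * a 4)%nat with (y + 3)%nat in C' by lia.
      assert (C0 : closer h y) by (apply (rec_closer 4); auto; lia).
      assert (T2 := transport h y 2 C0 ltac:(intros i Hi;
        assert (i = 1 \/ i = 2)%nat as [-> | ->] by lia; congruence)).
      simpl in T2. rewrite H1, H2 in T2.
      apply (closer_irrefl (h + 3)), (closer_trans _ (y + 3)); [exact C'|].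
      apply (sg_mul_closer 1); [left; reflexivity|lra|lra].
  - simpl. rewrite H1, H2. lra.
Qed.

(* Write [r], [R], [Q], [A] for [q (t+1)], [q (t+2)], [q (t+3)], [a (t+4)], and let
   [y = h + (A-1) Q], [u = h + A Q]. When [a (t+3) = 1], [u = y + R + r], and the point [y + R]
   controls the signs along [u] only before time [r]. Beyond it, [u + i r] is compared with
   [h + i r] for every [i]: a disagreement would persist until time [q (t+4)] and put the
   closest return there between two farther points on the same side of [0]. *)
Lemma tail_signs_1 t h : (1 <= t)%nat ->
  (forall g, rec (S (S t)) g -> block_periodic t g) ->
  (forall g, rec (S (S (S t))) g -> block_periodic (S t) g) ->
  (forall g j, rec (S (S (S t))) g -> (0 < j < q a (S (S t)))%nat -> sg (g + j) = sg j) ->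
  a (S (S (S t))) = 1%nat -> rec (S (S (S (S t)))) h ->
  forall j, (0 < j < q a (S (S t)))%nat ->
    sg (h + a (S (S (S (S t)))) * q a (S (S (S t))) + j) = sg (h + j).
Proof.
  intros Ht IHt IHp IHE Han H.
  assert (ER := q_SS a t). assert (EQ := q_SS a (S t)). assert (EQ4 := q_SS a (S (S t))).
  assert (Ht0 := q_pos t). assert (Ht0r := q_lt_S t Ht).
  assert (HrR := q_lt_S (S t) ltac:(lia)).
  assert (HA := a_pos (S (S (S (S t)))) ltac:(lia)).
  assert (Ha' := a_pos (S (S t)) ltac:(lia)).
  assert (H3 := rec_pred _ _ H). assert (H2 := rec_pred _ _ H3).
  assert (Hy := rec_sub _ h (a (S (S (S (S t)))) - 1) H ltac:(lia)).
  assert (Cr : forall i, (2 <= i <= a (S (S t)))%nat ->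
    closer (h + q a (S t)) (h + i * q a (S t))).
  { intros i Hi.
    assert (i * q a (S t) <= a (S (S t)) * q a (S t))%nat by (apply Nat.mul_le_mono_r; lia).
    apply (rec_after (S (S t))); auto; nia. }
  assert (Ch := fun k => rec_closer (S (S (S (S t)))) h k ltac:(lia) H).
  assert (Cq := fun k => rec_before _ h (S (S (S (S t)))) k H ltac:(lia)).
  destruct (IHt h H2) as (Sb & Sb' & _).
  destruct (IHp h H3) as (_ & _ & Pr).
  assert (Mb := fun i => sg_multiple t h i H2 (IHt h H2) Pr).
  destruct (IHp _ Hy) as (_ & Sy & _). rewrite Han in Sy, EQ.
  assert (Cy := rec_closer (S (S (S t))) _ (q a (S (S (S t)))) ltac:(lia) Hy ltac:(lia)).
  assert (CyR := rec_before _ _ (S (S (S t))) (q a (S (S t))) Hy ltac:(lia) ltac:(lia)).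
  assert (Eyh := fun j Hj => eq_trans (IHE _ j Hy Hj) (eq_sym (IHE _ j H3 Hj))).
  clear H H2 H3 Hy IHt IHp IHE Han.
  set (t0 := q a t) in *. set (r := q a (S t)) in *. set (R := q a (S (S t))) in *.
  set (Q := q a (S (S (S t)))) in *. set (Q4 := q a (S (S (S (S t))))) in *.
  set (A := a (S (S (S (S t))))) in *. set (a' := a (S (S t))) in *.
  set (y := (h + (A - 1) * Q)%nat) in *.
  set (u := (h + A * Q)%nat).
  assert (Eu : u = (y + Q)%nat).
  { unfold u, y. destruct A; [lia|]. rewrite Nat.sub_succ, Nat.sub_0_r. simpl. lia. }
  rewrite <- Eu in Cy, CyR.
  clearbody t0 r R Q Q4 A a'.
  (* Before time [r], [u] runs between [y] and [y + R], whose signs agree by the tail clause of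
     [block_periodic]. *)
  assert (Su : forall i, (0 < i < r)%nat -> sg (u + i) = sg (h + i)).
  { intros i Hi. rewrite <- Eyh by lia. apply (sandwich y u (y + R) r Cy CyR); [|exact Hi].
    intros k Hk. rewrite <- Sy by lia. f_equal. lia. }
  set (tau := sg (h + r)) in *.
  assert (Htau : is_sign tau) by apply sg_is_sign.
  assert (Htau' : is_sign (- tau)) by (destruct Htau as [-> | ->]; [right|left]; lra).
  set (b := fun i => (h + i * r)%nat). set (z := fun i => (u + i * r)%nat).
  assert (Ez : forall i, (z i + r = z (S i))%nat) by (intros; unfold z; simpl; lia).
  assert (Eb : forall i, (b i + r = b (S i))%nat) by (intros; unfold b; simpl; lia).
  assert (Eb1 : b 1%nat = (h + r)%nat) by (unfold b; lia).
  assert (Hir : forall i, (i <= a')%nat -> (i * r <= a' * r)%nat)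
    by (intros; apply Nat.mul_le_mono_r; lia).
  assert (Chz : forall i, (i <= a')%nat -> closer h (z i)).
  { intros i Hi. specialize (Hir i Hi).
    replace (z i) with (h + (A * Q + i * r))%nat by (unfold z, u; lia). apply Ch. nia. }
  assert (Cb : forall i, (1 <= i <= a')%nat -> forall k, closer k (b 1%nat) -> closer k (b i)).
  { intros i Hi k Hk. destruct (Nat.eq_dec i 1) as [->|]; [exact Hk|].
    rewrite Eb1 in Hk. apply (closer_trans _ _ _ Hk), Cr; lia. }
  assert (Sbr : forall i, (i < a')%nat -> forall k, (0 < k < r)%nat -> sg (b i + k) = sg (h + k)).
  { intros i Hi k Hk. apply Sb; assumption. }
  (* An odd block reverses [closer h (z i)] and [closer (z i) w] in the direction [tau]. *)
  assert (Move : forall i w, (i < a')%nat -> closer (z i) w ->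
    (forall k, (0 < k < r)%nat -> sg (w + k) = sg (h + k)) ->
    tau * x (w + r)%nat < tau * x (z (S i)) < tau * x (b 1%nat)).
  { intros i w Hi Hc Hw. specialize (Chz i ltac:(lia)).
    assert (Sz : forall k, (0 < k < r)%nat -> sg (z i + k) = sg (h + k))
      by (apply (sandwich h (z i) w); auto; intros; symmetry; auto).
    rewrite <- Ez, Eb1. split; apply transport_odd; auto; lia. }
  assert (Z1 : tau * x u < tau * x (z 1%nat) < tau * x (b 1%nat)).
  { replace (z 1%nat) with (u + r)%nat by (unfold z; lia).
    replace (x u) with (x (y + R + r)%nat) by (f_equal; lia). rewrite Eb1.
    split; apply transport_odd; auto; try lia.
    - intros i Hi. rewrite <- Eyh by lia. rewrite <- Sy by lia. f_equal. lia.
    - replace u with (z 0%nat) by (unfold z; lia). apply Chz; lia. }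
  assert (Pz : forall i, (1 <= i)%nat -> 0 < sg (z i) * x (z i))
    by (intros i Hi; apply sg_mul_pos; unfold z; nia).
  (* Here [z a' + t0] is the closest return [h + Q4], and [t0 < r] keeps time [t0] within the common
     signs. *)
  assert (Fin : forall w k, (0 < k)%nat -> (k + t0 < Q4)%nat -> w = (h + k)%nat ->
    (forall i, (0 < i < r)%nat -> sg (w + i) = sg (h + i)) -> closer (z a') w -> False).
  { intros w k Hk Hk' -> Hw Hc.
    assert (Ez4 : (z a' + t0 = h + Q4)%nat) by (unfold z, u; nia).
    apply (no_closest_between h (z a') (h + k) t0); auto.
    - intros i Hi. apply Hw. lia.
    - rewrite Ez4. apply Cq. nia.
    - rewrite Ez4, <- Nat.add_assoc. apply Cq. lia. }
  (* The two kinds of disagreement: [z 1] on the wrong side of [0], or [z i] closer than the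
     preceding [b (i - 1)]. [Move] passes [bad] on from [i] to [S i], and at [a'] it contradicts
     [Fin]. *)
  set (bad := fun i => (closer (z i) u /\ sg (z 1%nat) = - tau) \/
                       ((2 <= i)%nat /\ closer (z i) (b (i - 1)%nat))).
  assert (BadS : forall i, (1 <= i < a')%nat -> bad i -> bad (S i)).
  { intros i Hi B. assert (P := Pz (S i) ltac:(lia)).
    assert (Hb1 : sg (z (S i)) = tau -> tau * x (z (S i)) < tau * x (b 1%nat) ->
      closer (z (S i)) (b i)).
    { intros E L. apply Cb; [lia|]. rewrite E in P. apply (sg_mul_closer tau); auto; lra. }
    destruct B as [[B E1]|[Hi2 B]].
    - destruct (Move i u ltac:(lia) B Su) as [M1 M2].
      replace (u + r)%nat with (z 1%nat) in M1 by (unfold z; lia).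
      destruct (Req_dec (sg (z (S i))) tau) as [E|E].
      + right. split; [lia|]. rewrite Nat.sub_succ, Nat.sub_0_r. auto.
      + apply sg_neq in E; auto. left. split; [|exact E1]. rewrite E in P.
        apply (closer_trans _ (z 1%nat)).
        * apply (sg_mul_closer (- tau)); auto; lra.
        * assert (P1 := sg_mul_pos (z 1%nat) ltac:(unfold z; nia)). rewrite E1 in P1.
          apply (sg_mul_closer (- tau)); auto; lra.
    - destruct (Move i (b (i - 1)%nat) ltac:(lia) B (Sbr (i - 1)%nat ltac:(lia))) as [M1 M2].
      rewrite Eb in M1. replace (S (i - 1)) with i in M1 by lia.
      right. split; [lia|]. rewrite Nat.sub_succ, Nat.sub_0_r.
      destruct (Req_dec (sg (z (S i))) tau) as [E|E]; [auto|].
      apply sg_neq in E; auto. rewrite E in P.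
      apply (sg_mul_closer (- tau)); auto; lra. }
  assert (NoBad : forall i, (1 <= i <= a')%nat -> ~ bad i).
  { intros i Hi B.
    assert (Ba : forall d, (i + d <= a')%nat -> bad (i + d)%nat).
    { induction d as [|d IHd]; intros Hd; [rewrite Nat.add_0_r; exact B|].
      rewrite Nat.add_succ_r. apply BadS; [lia|]. apply IHd; lia. }
    specialize (Ba (a' - i)%nat ltac:(lia)).
    replace (i + (a' - i))%nat with a' in Ba by lia.
    destruct Ba as [[Ba _]|[Hi2 Ba]].
    - apply (Fin u (A * Q)%nat); auto; nia.
    - specialize (Hir (a' - 1)%nat ltac:(lia)).
      apply (Fin (b (a' - 1)%nat) ((a' - 1) * r)%nat); auto; [nia|nia|].
      apply Sbr; lia. }
  assert (S1 : sg (z 1%nat) = tau).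
  { destruct (Req_dec (sg (z 1%nat)) tau) as [E|E]; [exact E|exfalso].
    apply sg_neq in E; auto. apply (NoBad 1%nat); [lia|]. left. split; [|exact E].
    specialize (Pz 1%nat ltac:(lia)). rewrite E in Pz.
    apply (sg_mul_closer (- tau)); auto; lra. }
  assert (Good : forall i, (1 <= i <= a')%nat -> closer (z i) (b i) /\ sg (z i) = sg (b i)).
  { induction i as [|i IHi]; intros Hi; [lia|].
    assert (P := Pz (S i) ltac:(lia)).
    destruct (Nat.eq_dec i 0) as [->|Hi0].
    - rewrite S1 in *. split; [|rewrite Eb1; reflexivity].
      apply (sg_mul_closer tau); auto; lra.
    (* In the direction [tau], [z (S i)] lies between [b (S i)] and [b 1]. On the side [tau] it
       would be [bad], so it is on the side [- tau], as is [b (S i)]. *)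
    - destruct (IHi ltac:(lia)) as [C _].
      destruct (Move i (b i) ltac:(lia) C (Sbr i ltac:(lia))) as [M1 M2]. rewrite Eb in M1.
      destruct (Req_dec (sg (z (S i))) tau) as [E|E].
      + exfalso. apply (NoBad (S i)); [lia|]. right. split; [lia|].
        rewrite Nat.sub_succ, Nat.sub_0_r. apply Cb; [lia|]. rewrite E in P.
        apply (sg_mul_closer tau); auto; lra.
      + apply sg_neq in E; auto. rewrite E in P |- *.
        split; [apply (sg_mul_closer (- tau)); auto; lra|].
        symmetry. apply Mb. lia. }
  intros j Hj.
  assert (Ej := Nat.div_mod_eq j r). assert (Hm := Nat.mod_upper_bound j r ltac:(lia)).
  set (i := (j / r)%nat) in *. set (k := (j mod r)%nat) in *. clearbody i k.
  assert (Hi : (i <= a')%nat) by (apply Nat.le_ngt; intros c;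
    assert (r * S a' <= r * i)%nat by (apply Nat.mul_le_mono_l; lia); nia).
  replace (u + j)%nat with (z i + k)%nat by (unfold z; lia).
  replace (h + j)%nat with (b i + k)%nat by (unfold b; lia).
  destruct (Nat.eq_dec i 0) as [->|Hi0].
  { unfold z, b. rewrite !Nat.add_0_r. apply Su. lia. }
  destruct (Good i ltac:(lia)) as [C E].
  destruct (Nat.eq_dec k 0) as [->|Hk0]; [rewrite !Nat.add_0_r; exact E|].
  assert (Sbk : forall l, (0 < l < S k)%nat -> sg (b i + l) = sg (h + l)).
  { intros l Hl. destruct (Nat.eq_dec i a') as [->|].
    - apply Sb'. nia.
    - apply Sbr; lia. }
  rewrite Sbk by lia. apply (sandwich h (z i) (b i) (S k)); auto; [|lia].
  intros l Hl. symmetry. auto.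
Qed.

(** If [a (t+3)] is at least [2], the signs along [y + q a (t+2)] repeat those along [y] for a whole
    block, so a single [sandwich] suffices. *)
Lemma tail_signs t h : (1 <= t)%nat ->
  (forall g, rec (S (S t)) g -> block_periodic t g) ->
  (forall g, rec (S (S (S t))) g -> block_periodic (S t) g) ->
  (forall g j, rec (S (S (S t))) g -> (0 < j < q a (S (S t)))%nat -> sg (g + j) = sg j) ->
  rec (S (S (S (S t)))) h ->
  forall j, (0 < j < q a (S (S t)))%nat ->
    sg (h + a (S (S (S (S t)))) * q a (S (S (S t))) + j) = sg (h + j).
Proof.
  intros Ht IHt IHp IHE H.
  assert (Han := a_pos (S (S (S t))) ltac:(lia)).
  destruct (Nat.eq_dec (a (S (S (S t)))) 1) as [E|E]; [apply tail_signs_1; assumption|].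
  intros j Hj.
  assert (HA := a_pos (S (S (S (S t)))) ltac:(lia)).
  assert (HRQ := q_lt_S (S (S t)) ltac:(lia)).
  set (A := a (S (S (S (S t))))) in *.
  assert (Hy := rec_sub _ h (A - 1) H ltac:(unfold A; lia)).
  set (y := (h + (A - 1) * q a (S (S (S t))))%nat) in *.
  replace (h + A * q a (S (S (S t))))%nat with (y + q a (S (S (S t))))%nat
    by (unfold y; destruct A; [lia|]; rewrite Nat.sub_succ, Nat.sub_0_r; simpl; lia).
  rewrite (IHE h j), <- (IHE y j) by (auto; apply rec_pred; exact H).
  apply (sandwich y _ (y + q a (S (S t))) (q a (S (S t)))); [| | |exact Hj].
  - apply (rec_closer (S (S (S t)))); auto; lia.
  - apply (rec_before (S (S (S t)))); auto; lia.
  - intros i Hi. destruct (IHp y Hy) as (D1 & _).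
    rewrite <- (D1 1%nat) by lia. f_equal. lia.
Qed.

(** * Block periodicity: the induction *)

(** Odd parity fixes the sign at [q a (S p)], periodicity copies the block, and [sg_multiple] gives
    the signs at the multiples. *)
Lemma sg_ext_block p g h : rec (S (S p)) g -> rec (S (S p)) h ->
  block_periodic p g -> block_periodic p h ->
  sgprod g (q a (S p)) = -1 -> sgprod h (q a (S p)) = -1 ->
  (forall i, (0 < i < q a (S p))%nat -> sg (g + i) = sg (h + i)) ->
  forall j, (0 < j < q a (S (S p)))%nat -> sg (g + j) = sg (h + j).
Proof.
  intros Hg Hh Dg Dh Pg Ph Hs j Hj.
  assert (HR := q_pos (S p)). assert (EQ := q_SS a p). assert (Hr := q_pos p).
  assert (SR : sg (g + q a (S p)) = sg (h + q a (S p))).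
  { destruct (q a (S p)) as [|R]; [lia|]. simpl in Pg, Ph.
    rewrite (sgprod_ext g h R) in Pg by (intros; apply Hs; lia).
    destruct (sgprod_is_sign h R) as [E|E]; rewrite E in *; lra. }
  assert (Mg := fun m => sg_multiple p g m Hg Dg Pg).
  assert (Mh := fun m => sg_multiple p h m Hh Dh Ph).
  destruct Dg as (D1 & D2 & _), Dh as (D1' & D2' & _).
  assert (Ej := Nat.div_mod_eq j (q a (S p))).
  assert (Hk := Nat.mod_upper_bound j (q a (S p)) ltac:(lia)).
  set (m := (j / q a (S p))%nat) in *. set (k := (j mod q a (S p))%nat) in *. clearbody m k.
  set (R := q a (S p)) in *. set (A := a (S (S p))) in *.
  assert (Hpr : (q a p <= R)%nat).
  { destruct p as [|p]; [unfold R; rewrite q_1; cbn; lia|].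
    assert (T := q_lt_S (S p) ltac:(lia)). unfold R. lia. }
  assert (Hm : (m <= A)%nat) by (apply Nat.le_ngt; intros c;
    assert (R * S A <= R * m)%nat by (apply Nat.mul_le_mono_l; lia); nia).
  replace (g + j)%nat with (g + m * R + k)%nat by lia.
  replace (h + j)%nat with (h + m * R + k)%nat by lia.
  destruct (Nat.eq_dec k 0) as [->|Hk0].
  - rewrite !Nat.add_0_r.
    destruct (Nat.eq_dec m 1) as [->|]; [rewrite Nat.mul_1_l; exact SR|].
    rewrite Mg, Mh, SR by nia. reflexivity.
  - destruct (Nat.eq_dec m A) as [->|].
    + rewrite D2, D2' by nia. apply Hs. lia.
    + rewrite D1, D1' by lia. apply Hs. lia.
Qed.

Lemma rec_multiples_closer N h m m' : (1 <= N)%nat -> rec (S N) h ->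
  (m < m' <= a (S N))%nat -> closer (h + m * q a N) (h + m' * q a N).
Proof.
  intros HN H. induction m' as [|m' IH]; intros Hm; [lia|].
  assert (C : closer (h + m' * q a N) (h + S m' * q a N)).
  { assert (Hq := q_pos N).
    replace (h + S m' * q a N)%nat with (h + m' * q a N + q a N)%nat by (simpl; lia).
    apply (rec_closer N); [exact HN|apply rec_sub; auto; lia|lia]. }
  destruct (Nat.eq_dec m m') as [->|]; [exact C|].
  apply (closer_trans _ (h + m' * q a N)); [apply IH; lia|exact C].
Qed.

Lemma block_periodic_step t h : (1 <= t)%nat ->
  (forall g, rec (S (S t)) g -> block_periodic t g) ->
  (forall g, rec (S (S (S t))) g -> block_periodic (S t) g) ->
  (forall g j, rec (S (S (S t))) g -> (0 < j < q a (S (S t)))%nat -> sg (g + j) = sg j) ->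
  rec (S (S (S (S t)))) h -> block_periodic (S (S t)) h.
Proof.
  intros Ht IHt IHp IHE H.
  assert (F := tail_signs t h Ht IHt IHp IHE H).
  assert (H3 := rec_pred _ _ H).
  assert (EQ4 := q_SS a (S (S t))).
  assert (HR := q_pos (S (S t))).
  assert (HQ := q_pos (S (S (S t)))).
  assert (HA := a_pos (S (S (S (S t)))) ltac:(lia)).
  assert (Chain := fun m => rec_multiples_closer (S (S (S t))) h m (a (S (S (S (S t)))))
                     ltac:(lia) H).
  assert (Cu : closer h (h + a (S (S (S (S t)))) * q a (S (S (S t))))).
  { assert (C := Chain 0%nat ltac:(lia)). rewrite Nat.add_0_r in C. exact C. }
  assert (C4 := fun j => rec_before _ h (S (S (S (S t)))) j H ltac:(lia)).
  set (u := (h + a (S (S (S (S t)))) * q a (S (S (S t))))%nat) in *.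
  assert (Eu : (u + q a (S (S t)) = h + q a (S (S (S (S t)))))%nat) by (unfold u; lia).
  assert (CR := C4 (q a (S (S t))) ltac:(nia)).
  assert (P : sgprod h (q a (S (S t))) = -1).
  { rewrite <- Eu in CR. destruct (q a (S (S t))) as [|R]; [lia|].
    assert (T := transport h u R Cu ltac:(intros; symmetry; apply F; lia)).
    apply closer_sg_mul in CR; [|lia]. simpl.
    destruct (sg_is_sign (h + S R)) as [E|E], (sgprod_is_sign h R) as [E'|E'];
      rewrite E, E' in *; lra. }
  split; [|split; [exact F|exact P]].
  intros m j Hm Hj.
  destruct (Nat.eq_dec m 0) as [->|Hm0]; [rewrite Nat.add_0_r; reflexivity|].
  assert (Hy := rec_sub _ _ _ H Hm).
  assert (Hmle : (m * q a (S (S (S t))) + q a (S (S (S t)))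
                  <= a (S (S (S (S t)))) * q a (S (S (S t))))%nat).
  { replace (m * q a (S (S (S t))) + q a (S (S (S t))))%nat
      with (S m * q a (S (S (S t))))%nat by (simpl; lia).
    apply Nat.mul_le_mono_r. exact Hm. }
  specialize (Chain m ltac:(lia)). fold u in Chain.
  assert (Sy : forall i, (0 < i < q a (S (S t)))%nat ->
    sg (h + m * q a (S (S (S t))) + i) = sg (h + i)).
  { intros i Hi. rewrite (IHE h), IHE by auto. reflexivity. }
  (* The block start is closer than [u], so odd parity leaves [u + q a (t+2)] behind it; but that
     point is the closest return [h + q a (t+4)], which forces the sign. *)
  assert (SR : sg (h + m * q a (S (S (S t))) + q a (S (S t))) = sg (h + q a (S (S t)))).
  { apply (sg_of_farther _ (u + q a (S (S t)))).
    - apply sg_is_sign.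
    - lia.
    - rewrite Eu, <- Nat.add_assoc. apply C4. lia.
    - apply transport_odd; auto. }
  apply (sg_ext_block (S t)); auto.
  rewrite <- P. apply sgprod_ext. intros i Hi.
  destruct (Nat.eq_dec i (q a (S (S t)))) as [->|]; [exact SR|]. apply Sy. lia.
Qed.

Hypothesis rec_0 : forall N, rec N 0.

(** Each step needs the two preceding levels and the third clause, which ties every recurrent
    segment to the critical orbit; that clause is renewed by comparison with time [0], recurrent to
    every depth. *)
Lemma block_periodic_all p : (1 <= p)%nat ->
  (forall h, rec (S (S p)) h -> block_periodic p h) /\
  (forall h, rec (S (S (S p))) h -> block_periodic (S p) h) /\
  (forall g j, rec (S (S (S p))) g -> (0 < j < q a (S (S p)))%nat -> sg (g + j) = sg j).
Proof.
  intros Hp. induction p as [|p IH]; [lia|].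
  destruct (Nat.eq_dec p 0) as [->|Hp0].
  - split; [exact block_periodic_1|split; [exact block_periodic_2|]].
    intros g j Hg Hj. rewrite q_3 in Hj.
    destruct (sg_first g (rec_pred _ _ Hg)) as [G1 G2].
    destruct (sg_first 0 (rec_0 3)) as [Z1 Z2].
    assert (j = 1 \/ j = 2)%nat as [-> | ->] by lia; [rewrite G1 | rewrite G2]; auto.
  - destruct (IH ltac:(lia)) as (I1 & I2 & I3).
    assert (I4 : forall h, rec (S (S (S (S p)))) h -> block_periodic (S (S p)) h)
      by (intros h Hh; apply block_periodic_step; auto; lia).
    split; [exact I2|split; [exact I4|]].
    intros g j Hg Hj. apply (sg_ext_block (S p) g 0); auto.
    + apply rec_pred, Hg.
    + apply I2, rec_pred, Hg.
    + apply I4, Hg.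
    + apply I4, rec_0.
    + intros i Hi. apply I3; [apply rec_pred, Hg|exact Hi].
Qed.

(** * Signs along the critical orbit *)

Lemma block_periodic_0 p : (1 <= p)%nat -> block_periodic p 0.
Proof. intros Hp. apply block_periodic_all; [exact Hp|apply rec_0]. Qed.

Lemma sgprod_q n : (1 <= n)%nat -> sgprod 0 (q a n) = -1.
Proof. intros Hn. apply (block_periodic_0 n Hn). Qed.

Lemma sg_mul_q n m : (1 <= n)%nat -> (2 <= m <= a (S n))%nat ->
  sg (m * q a n) = - sg (q a n).
Proof.
  intros Hn Hm. destruct n as [|p]; [lia|].
  destruct (Nat.eq_dec p 0) as [->|Hp]; [rewrite a2 in Hm; lia|].
  apply (sg_multiple p 0); auto.
  - apply block_periodic_0. lia.
  - apply sgprod_q. lia.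
Qed.

(** Each further block repeats the first except for the opposite sign at its end, so it contributes
    [1]. *)
Lemma sgprod_mul_q n m : (1 <= n)%nat -> (1 <= m <= a (S (S n)))%nat ->
  sgprod 0 (m * q a (S n)) = -1.
Proof.
  intros Hn. induction m as [|m IH]; intros Hm; [lia|].
  assert (P := sgprod_q (S n) ltac:(lia)).
  destruct (Nat.eq_dec m 0) as [->|Hm0]; [rewrite Nat.mul_1_l; exact P|].
  assert (M := sg_mul_q (S n) (S m) ltac:(lia) ltac:(lia)).
  assert (HQ := q_pos (S n)).
  destruct (block_periodic_0 n Hn) as (D1 & _). specialize (D1 m).
  replace (S m * q a (S n))%nat with (m * q a (S n) + q a (S n))%nat in * by (simpl; lia).
  rewrite sgprod_add, (IH ltac:(lia)).
  rewrite Nat.add_0_l. set (v := (m * q a (S n))%nat) in *.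
  destruct (q a (S n)) as [|Q]; [lia|]. simpl in *.
  rewrite (sgprod_ext v 0 Q), M by (intros; apply D1; lia).
  destruct (sgprod_is_sign 0 Q) as [E|E]; rewrite E in *; lra.
Qed.

(** After [a (n+2)] blocks, of total product [-1], the tail up to [q a (n+2)] has product [1]. It
    repeats the first [q a n] signs, of product [-1], except at its end. *)
Lemma sg_q_SS n : (1 <= n)%nat -> sg (q a (S (S n))) = - sg (q a n).
Proof.
  intros Hn. assert (HA := a_pos (S (S n)) ltac:(lia)).
  assert (P1 := sgprod_mul_q n (a (S (S n))) Hn ltac:(lia)).
  assert (P2 := sgprod_q (S (S n)) ltac:(lia)).
  assert (P3 := sgprod_q n Hn).
  destruct (block_periodic_0 n Hn) as (_ & D2 & _).
  assert (Hr := q_pos n). rewrite q_SS in *.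
  rewrite sgprod_add, P1, Nat.add_0_l in P2. rewrite Nat.add_0_l in D2.
  set (v := (a (S (S n)) * q a (S n))%nat) in *.
  destruct (q a n) as [|r]; [lia|]. simpl in P2, P3.
  rewrite (sgprod_ext v 0 r) in P2 by (intros; apply D2; lia).
  destruct (sgprod_is_sign 0 r) as [E|E], (sg_is_sign (S r)) as [E'|E'];
    rewrite E, E' in *; lra.
Qed.

Lemma sg_q n : (1 <= n)%nat ->
  ((n mod 4 = 0 \/ n mod 4 = 1)%nat -> sg (q a n) = -1) /\
  ((n mod 4 = 2 \/ n mod 4 = 3)%nat -> sg (q a n) = 1).
Proof.
  assert (S12 : sg (q a 1) = -1 /\ sg (q a 2) = 1)
    by (rewrite q_1, q_2; apply (sg_first 0), rec_0).
  assert (K : forall k, sg (q a (1 + 4 * k)) = -1 /\ sg (q a (2 + 4 * k)) = 1).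
  { induction k as [|k IH]; [exact S12|].
    replace (1 + 4 * S k)%nat with (S (S (S (S (1 + 4 * k))))) by lia.
    replace (2 + 4 * S k)%nat with (S (S (S (S (2 + 4 * k))))) by lia.
    rewrite !sg_q_SS by lia. destruct IH as [-> ->]. split; lra. }
  intros Hn.
  assert (En := Nat.div_mod_eq n 4). assert (Hm := Nat.mod_upper_bound n 4 ltac:(lia)).
  set (k := (n / 4)%nat) in *. set (d := (n mod 4)%nat) in *. clearbody k d.
  assert (d = 0 \/ d = 1 \/ d = 2 \/ d = 3)%nat as [-> |[-> |[-> | ->]]] by lia;
    split; intros [?|?]; try lia.
  - destruct k as [|k]; [lia|]. replace n with (S (S (2 + 4 * k))) by lia.
    rewrite sg_q_SS by lia. destruct (K k) as [_ ->]. lra.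
  - replace n with (1 + 4 * k)%nat by lia. apply K.
  - replace n with (2 + 4 * k)%nat by lia. apply K.
  - replace n with (S (S (1 + 4 * k))) by lia.
    rewrite sg_q_SS by lia. destruct (K k) as [-> _]. lra.
Qed.

(** A maximal digit forces a zero below it, so the induction drops two levels; a smaller digit
    leaves room for a whole [q a (S M)]. *)
Lemma ost_sum_lt g N M : ostrowski_digits a g N -> (ost_sum a g M < q a (S M))%nat.
Proof.
  intros (_ & G1 & G2). induction M as [M IH] using lt_wf_ind.
  destruct M as [|M]; [apply q_pos|]. rewrite q_SS. simpl.
  assert (Hr := q_pos M). specialize (G1 (S M) ltac:(lia)).
  destruct (Nat.eq_dec (g (S M)) (a (S (S M)))) as [E|E].
  - destruct M as [|M]; [simpl; rewrite E; lia|].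
    specialize (G2 (S (S M)) ltac:(lia) E). rewrite Nat.sub_succ, Nat.sub_0_r in G2.
    specialize (IH M ltac:(lia)). cbn [ost_sum]. rewrite G2, E. lia.
  - specialize (IH M ltac:(lia)).
    assert (S (g (S M)) * q a (S M) <= a (S (S M)) * q a (S M))%nat
      by (apply Nat.mul_le_mono_r; lia).
    lia.
Qed.

Lemma ost_sum_0 g M : (forall n, (1 <= n <= M)%nat -> g n = 0%nat) -> ost_sum a g M = 0%nat.
Proof.
  induction M as [|M IH]; intros H; [reflexivity|].
  simpl. rewrite IH, H by (intros; try apply H; lia). reflexivity.
Qed.

(** Adding the top digit shifts by whole blocks. If that digit is maximal, only the tail clause of
    [block_periodic] applies; the zero digit below it keeps the partial sum under [q a M]. *)
Lemma sg_ost_sum g N m : ostrowski_digits a g N -> (1 <= m)%nat -> (0 < g m)%nat ->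
  (forall n, (1 <= n < m)%nat -> g n = 0%nat) ->
  forall M, (m <= M)%nat -> sg (ost_sum a g M) = sg (g m * q a m).
Proof.
  intros HO Hm Hg H0 M HM. induction HM as [|M HM IH].
  - destruct m as [|m]; [lia|]. simpl ost_sum.
    rewrite ost_sum_0 by (intros; apply H0; lia). reflexivity.
  - assert (Hpos : (0 < ost_sum a g M)%nat).
    { clear IH. induction HM as [|M HM IHM]; [|simpl; lia].
      destruct m as [|m]; [lia|]. simpl. assert (T := q_pos (S m)). nia. }
    assert (L := ost_sum_lt g N M HO).
    rewrite <- IH. simpl. rewrite Nat.add_comm.
    destruct (block_periodic_0 M ltac:(lia)) as (D1 & D2 & _).
    destruct (Nat.eq_dec (g (S M)) (a (S (S M)))) as [E|E].
    + rewrite E. apply D2. split; [exact Hpos|].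
      assert (L' := ost_sum_lt g N (M - 1) HO).
      destruct M as [|M]; [lia|]. rewrite Nat.sub_succ, Nat.sub_0_r in L'.
      destruct HO as (_ & _ & G2). specialize (G2 (S (S M)) ltac:(lia) E).
      rewrite Nat.sub_succ, Nat.sub_0_r in G2. simpl. rewrite G2. lia.
    + destruct HO as (_ & G1 & _). specialize (G1 (S M) ltac:(lia)).
      apply D1; lia.
Qed.

End FoldedOrbit.

(** * From the unimodal map to its critical orbit *)

(** [IVT] takes a function continuous on all of [R]; clamping the argument gives one that agrees
    with [f] on [I]. *)
Lemma clamp_continuous (f : R -> R) :
  (forall x, inI x -> forall eps, 0 < eps -> exists delta, 0 < delta /\
      forall y, inI y -> Rabs (y - x) < delta -> Rabs (f y - f x) < eps) ->
  continuity (fun y => f (Rmax (-1) (Rmin y 1))).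
Proof.
  intros Hc y eps Heps.
  assert (inI_clamp : forall z, inI (Rmax (-1) (Rmin z 1)))
    by (intros z; unfold inI, Rmin; destruct (Rle_dec z 1); unfold Rmax;
        destruct (Rle_dec (-1) _); lra).
  destruct (Hc _ (inI_clamp y) eps Heps) as (d & Hd & H).
  exists d. split; [exact Hd|]. intros z [_ Hz]. simpl in *. unfold Rdist in *.
  apply H; [apply inI_clamp|].
  apply Rle_lt_trans with (2 := Hz).
  unfold Rmin. destruct (Rle_dec z 1), (Rle_dec y 1); unfold Rmax;
    repeat destruct (Rle_dec (-1) _); unfold Rabs; repeat destruct (Rcase_abs _); lra.
Qed.

Lemma intermediate_value_I (f : R -> R) (s c l r : R) : unimodal f ->
  -1 <= l -> l < r -> r <= 1 -> s * (f l - c) < 0 -> 0 < s * (f r - c) ->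
  exists z, l <= z <= r /\ f z = c.
Proof.
  intros (_ & Hc & _) Hl Hlr Hr Hfl Hfr.
  assert (E : forall z, -1 <= z <= 1 -> Rmax (-1) (Rmin z 1) = z)
    by (intros z Hz; rewrite Rmin_left, Rmax_right; lra).
  set (g := fun y => s * (f (Rmax (-1) (Rmin y 1)) - c)).
  assert (Cg : continuity g).
  { unfold g. apply (continuity_scal (fun y => f (Rmax (-1) (Rmin y 1)) - c)).
    apply (continuity_minus (fun y => f (Rmax (-1) (Rmin y 1))) (fun _ => c)).
    - apply clamp_continuous, Hc.
    - apply continuity_const. intros ? ?; reflexivity. }
  destruct (IVT g l r) as (z & Hz & Ez); auto.
  - unfold g. rewrite E; lra.
  - unfold g. rewrite E; lra.
  - exists z. split; [exact Hz|]. unfold g in Ez. rewrite E in Ez by lra.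
    apply Rmult_integral in Ez. destruct Ez as [->|Ez]; lra.
Qed.

(** The opposite end of [I] serves if [f x = 1]; otherwise [f x] lies strictly between [f 0] and
    [1], the values at the ends of the opposite half. *)
Lemma exists_prime (f : R -> R) (x : R) : unimodal f -> inI x -> x <> 0 ->
  exists x', inI x' /\ x * x' < 0 /\ f x' = f x.
Proof.
  intros Hf Hx Hx0. assert (Hf' := Hf). destruct Hf' as (HI & _ & Hd & Hi & Hm1 & H1).
  assert (Hfx := HI x Hx). unfold inI in *.
  destruct (Rlt_le_dec 0 x) as [Hp|Hn].
  - destruct (Req_dec (f x) 1) as [E|E]; [exists (-1); split; [lra|split; [lra|congruence]]|].
    assert (f 0 < f x) by (apply Hi; lra).
    destruct (intermediate_value_I f (-1) (f x) (-1) 0 Hf) as (z & Hz & Ez); try lra.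
    exists z. split; [lra|split; [|exact Ez]].
    assert (z <> 0) by (intros ->; lra). nra.
  - destruct (Req_dec (f x) 1) as [E|E]; [exists 1; split; [lra|split; [lra|congruence]]|].
    assert (f 0 < f x) by (apply Hd; lra).
    destruct (intermediate_value_I f 1 (f x) 0 1 Hf) as (z & Hz & Ez); try lra.
    exists z. split; [lra|split; [|exact Ez]].
    assert (z <> 0) by (intros ->; lra). nra.
Qed.

Lemma not_in_Ix_lt (f : R -> R) (x y : R) : unimodal f -> inI x -> inI y ->
  ~ in_Ix f x y -> f x < f y.
Proof.
  intros Hf Hx Hy H. assert (Hf' := Hf). destruct Hf' as (_ & _ & Hd & Hi & _).
  destruct (Req_dec x 0) as [->|Hx0].
  - destruct (Rtotal_order y 0) as [h|[h|h]].
    + apply Hd; unfold inI in *; lra.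
    + exfalso. apply H. exists 0. split; [left; auto|].
      rewrite Rmin_left, Rmax_left; lra.
    + apply Hi; unfold inI in *; lra.
  - destruct (exists_prime f x Hf Hx Hx0) as (x' & Hx' & Hxx & E).
    assert (Hout : ~ Rmin x x' <= y <= Rmax x x').
    { intros c. apply H. exists x'. split; [right|exact c].
      repeat split; auto; try apply Hx'. intros ->. nra. }
    unfold inI in *.
    destruct (Rlt_le_dec 0 x) as [Hp|Hn].
    + assert (x' < 0) by nra. rewrite Rmin_right, Rmax_left in Hout by lra.
      destruct (Rlt_le_dec x y) as [h|h]; [apply Hi; lra|].
      rewrite <- E. apply Hd; lra.
    + assert (0 < x') by nra. rewrite Rmin_left, Rmax_right in Hout by lra.
      destruct (Rlt_le_dec y x) as [h|h]; [apply Hd; lra|].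
      rewrite <- E. apply Hi; lra.
Qed.

Lemma orb_add (f : R -> R) (h k : nat) (x : R) : orb f k (orb f h x) = orb f (h + k) x.
Proof. unfold orb. rewrite Nat.add_comm, Nat.iter_add. reflexivity. Qed.

Lemma inI_orb (f : R -> R) (k : nat) : unimodal f -> inI (orb f k 0).
Proof.
  intros (HI & _). induction k as [|k IH]; [unfold inI; simpl; lra|].
  apply HI. exact IH.
Qed.

Lemma has_recurrence_rec (a : nat -> nat) (f : R -> R) (N h : nat) : unimodal f ->
  has_recurrence a f N (orb f h 0) -> rec (fun k => orb f k 0) a N h.
Proof.
  intros Hf. revert h. induction N as [|N IH]; intros h H; [exact I|].
  destruct H as (H1 & H2 & H3). split; [|split].
  - intros k Hk. specialize (H1 k Hk). rewrite orb_add in H1.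
    apply (not_in_Ix_lt f (orb f h 0) (orb f (h + k) 0)); auto; apply inI_orb; exact Hf.
  - intros k Hk. rewrite <- (H2 k Hk). unfold closest_time. split.
    + intros H. split; [lia|]. intros j Hj. rewrite !orb_add. apply H. exact Hj.
    + intros [_ H] j Hj. specialize (H j Hj). rewrite !orb_add in H. exact H.
  - intros m Hm. apply IH. rewrite <- orb_add. apply H3. exact Hm.
Qed.

(** A coincidence at times [i < j] can be shifted until [j] becomes a denominator, [q_ge] supplying
    one beyond [j]; a strict closest time would then only tie with an earlier one. *)
Lemma critical_orbit_inj (a : nat -> nat) (f : R -> R) :
  (forall n, (1 <= n)%nat -> (1 <= a n)%nat) -> a 1%nat = 1%nat ->
  theta_recurrent a f ->
  forall i j, orb f i 0 = orb f j 0 -> i = j.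
Proof.
  intros Ha Ha1 Hrec.
  assert (L : forall i j, (i < j)%nat -> orb f i 0 <> orb f j 0).
  { intros i j Hij E.
    assert (Hq := q_ge a Ha Ha1 (S j)).
    destruct (Hrec (S j) ltac:(lia)) as (_ & H & _).
    destruct (proj2 (H (q a (S j)) ltac:(lia))) as [_ H'].
    { exists (S j). split; [lia|reflexivity]. }
    specialize (H' (i + (q a (S j) - j))%nat ltac:(lia)).
    rewrite <- (orb_add f i), E, orb_add in H'.
    replace (j + (q a (S j) - j))%nat with (q a (S j)) in H' by lia. lra. }
  intros i j E. destruct (Nat.lt_trichotomy i j) as [h|[h|h]]; [|exact h|];
    exfalso; [apply (L i j h)|apply (L j i h)]; auto.
Qed.

Theorem theorem2p4 (a : nat -> nat)
  (Ha : forall n, (1 <= n)%nat -> (1 <= a n)%nat)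
  (Ha1 : a 1%nat = 1%nat) (Ha2 : a 2%nat = 1%nat) (Ha3 : a 3%nat = 1%nat)
  (f : R -> R) (Hf : unimodal f) (Hrec : theta_recurrent a f) :
  (* (1) *)
  (forall n, (1 <= n)%nat ->
     ((n mod 4 = 0 \/ n mod 4 = 1)%nat -> orb f (q a n) 0 < 0) /\
     ((n mod 4 = 2 \/ n mod 4 = 3)%nat -> orb f (q a n) 0 > 0)) /\
  (* (2) *)
  (forall n gam k, (1 <= n)%nat -> (1 < gam <= a (S n))%nat -> k = (gam * q a n)%nat ->
     (0 < k)%nat -> orb f (q a n) 0 * orb f k 0 < 0) /\
  (* (3) *)
  (forall g N k m, ostrowski_digits a g N -> k = ost_sum a g N -> (0 < k)%nat ->
     (1 <= m)%nat -> (0 < g m)%nat -> (forall n, (1 <= n < m)%nat -> g n = 0%nat) ->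
     orb f k 0 * orb f (g m * q a m) 0 > 0).
Proof.
  set (x := fun k => orb f k 0).
  assert (Rec0 : forall N, rec x a N 0).
  { intros [|N]; [exact I|]. apply has_recurrence_rec; [exact Hf|]. apply Hrec. lia. }
  assert (Inj : forall i j, x i = x j -> i = j) by exact (critical_orbit_inj a f Ha Ha1 Hrec).
  assert (Hx := fun k => inI_orb f k Hf). unfold inI in Hx.
  destruct Hf as (_ & _ & Hd & Hi & _).
  assert (Pm : forall i j, 0 <= x i -> x i < x j -> x (S i) < x (S j))
    by (intros i j H1 H2; apply Hi; auto; apply Hx).
  assert (Nm : forall i j, x j <= 0 -> x i < x j -> x (S j) < x (S i))
    by (intros i j H1 H2; apply Hd; auto; apply Hx).
  assert (Pos := sg_mul_pos x eq_refl Inj).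
  assert (Hq := q_pos a Ha1).
  split; [|split].
  - intros n Hn. change (orb f (q a n) 0) with (x (q a n)). specialize (Pos (q a n) (Hq n)).
    destruct (sg_q x eq_refl Inj Pm Nm a Ha Ha1 Ha2 Ha3 Rec0 n Hn) as [E1 E2].
    split; intros H; [rewrite (E1 H) in Pos | rewrite (E2 H) in Pos]; lra.
  - intros n gam k Hn Hg -> Hk.
    change (x (q a n) * x (gam * q a n)%nat < 0).
    assert (E := sg_mul_q x eq_refl Inj Pm Nm a Ha Ha1 Ha2 Ha3 Rec0 n gam Hn ltac:(lia)).
    assert (P1 := Pos (q a n) (Hq n)). assert (P2 := Pos (gam * q a n)%nat Hk).
    rewrite E in P2. destruct (sg_is_sign x (q a n)) as [E'|E']; rewrite E' in *; nra.
  - intros g N k m HO -> Hk Hm Hg H0.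
    change (0 < x (ost_sum a g N) * x (g m * q a m)%nat).
    assert (HmN : (m <= N)%nat).
    { apply Nat.le_ngt. intros c. destruct HO as (HO & _). rewrite (HO m c) in Hg. lia. }
    assert (E := sg_ost_sum x eq_refl Inj Pm Nm a Ha Ha1 Ha2 Ha3 Rec0 g N m HO Hm Hg H0 N HmN).
    assert (P1 := Pos _ Hk). assert (P2 := Pos (g m * q a m)%nat ltac:(specialize (Hq m); nia)).
    rewrite E in P1.
    destruct (sg_is_sign x (g m * q a m)) as [E'|E']; rewrite E' in *; nra.
Qed.
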